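(* Let $X$ be a set of exactly three positive integers, and let $\mathcal{G}_X$ be the nim sequence of the all-but subtraction game with finite excluded subtraction set $X$. Then $\mathcal{G}_X$ is purely arithmetic periodic: there exist integers $p\geq 1$ and $s\geq 0$ such that $\mathcal{G}_X(n+p)=\mathcal{G}_X(n)+s$ for all $n\geq 0$.
   Context: For a finite set $X$ of positive integers, the all-but subtraction game with finite excluded subtraction set $X$ is the subtraction game with subtraction set $S=\{1,2,3,\dots\}\setminus X$: a position is a heap of $n\geq 0$ counters, and a move removes $s$ counters for some $s\in S$ with $s\leq n$. Its nim sequence is defined recursively by $\mathcal{G}_X(n)=\operatorname{mex}\{\mathcal{G}_X(n-s): s\in S,\ s\leq n\}$ for $n\ge 0$, where $\operatorname{mex}$ of a set of nonnegative integers is the least nonnegative integer not in it. *)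

(* Defs.v *)
From mathcomp Require Import all_boot finmap.

Set Implicit Arguments.
Unset Strict Implicit.
Unset Printing Implicit Defensive.

Lemma ex_notin (A : seq nat) : exists m, m \notin A.
Proof.
exists (\max_(i <- A) i).+1; apply/negP => mA.
by have := @leq_bigmax_seq _ A predT id _ mA isT; rewrite ltnn.
Qed.

Definition mex (A : seq nat) : nat := ex_minn (ex_notin A).

Lemma mex_notin (A : seq nat) : mex A \notin A.
Proof. by rewrite /mex; case: ex_minnP. Qed.

Lemma mex_min (A : seq nat) m : m < mex A -> m \in A.
Proof.
rewrite /mex; case: ex_minnP => k _ kmin lt_mk.
by apply: contraLR lt_mk => /kmin; rewrite -leqNgt.
Qed.

(* The legal moves from a heap of n counters: all s in S with 1 <= s <= n. *)
Definition moves (S : pred nat) (n : nat) : seq nat := [seq s <- iota 1 n | S s].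

(* [:: G 0; ...; G n.-1], where G is the nim sequence of the subtraction set S;
   the recursive equation characterizing G is nim_seqE below. *)
Fixpoint nim_values (S : pred nat) (n : nat) : seq nat :=
  if n is m.+1 then
    let g := nim_values S m in
    rcons g (mex [seq nth 0 g (m - s) | s <- moves S m])
  else [::].

Definition nim_seq (S : pred nat) (n : nat) : nat := nth 0 (nim_values S n.+1) n.

Lemma size_nim_values S n : size (nim_values S n) = n.
Proof. by elim: n => //= n IHn; rewrite size_rcons IHn. Qed.

Lemma nth_nim_values S n i : i < n -> nth 0 (nim_values S n) i = nim_seq S i.
Proof.
elim: n => // n IHn; rewrite ltnS leq_eqVlt => /predU1P[-> // | lt_in].
by rewrite /= nth_rcons size_nim_values lt_in IHn.
Qed.

Lemma nim_seqE S n :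
  nim_seq S n = mex [seq nim_seq S (n - s) | s <- moves S n].
Proof.
rewrite {1}/nim_seq /= nth_rcons size_nim_values ltnn eqxx; congr mex.
apply/eq_in_map => s; rewrite mem_filter mem_iota => /and3P[_ s_gt0 s_le].
by rewrite nth_nim_values // ltn_subrL s_gt0 (leq_trans s_gt0).
Qed.

Definition all_but (X : {fset nat}) : pred nat :=
  fun s => (0 < s) && (s \notin X).

(* Main.v *)
Require Import Defs.
From mathcomp Require Import all_boot finmap zify.

(** Positions of equal value form classes whose differences lie in [X], chosen
    greedily from the least unused position, the root.  Let [a < b < c] be the
    elements of [X].  If [c <> a + b] or [b = 2 a], each class is a progression
    [r, r + a, ..., r + (k - 1) a] with [k] least such that [k a] is not in [X],
    and [k a] is a period.  If [c = a + b] and [b <> 2 a], the class of a root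
    [r] is [{r, r + a, r + c}], or [{r, r + b, r + c}] when [r + a] is already
    used: indeed [r + b] could only be used by the class of [r - a], but that
    class would have taken [r] first.  For the same reason the occupancy of the
    window [[m, m + c)] determines the occupancy of the previous one, so the
    sequence of windows, being injective on finitely many states, returns to its
    initial empty state. *)

(** The first hypothesis keeps [f n] off the values of its options and the second puts every smaller
    value among them, so [f] obeys the mex recursion. *)
Lemma nim_seq_unique (S : pred nat) (f : nat -> nat) :
    (forall m n, m < n -> S (n - m) -> f m <> f n) ->
    (forall n v, v < f n -> exists m, [/\ m < n, S (n - m) & f m = v]) ->
  forall n, nim_seq S n = f n.
Proof.
move=> f_neq f_onto n; have [N] := ubnP n; elim: N n => // N IHN n ltnN.
rewrite nim_seqE; set A := map _ _.
have mem_A v : reflect (exists m, [/\ m < n, S (n - m) & f m = v]) (v \in A).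
  apply: (iffP mapP) => [[s] | [m [lt_mn Snm <-]]].
    rewrite mem_filter mem_iota => /and3P[Ss s_gt0 s_le] ->.
    exists (n - s); rewrite IHN; last by lia.
    by split=> //; [lia | rewrite subKn //; lia].
  exists (n - m); first by rewrite mem_filter Snm mem_iota; lia.
  by rewrite subKn 1?ltnW // IHN //; lia.
case: (ltngtP (mex A) (f n)) => // [lt_mex | /mex_min/mem_A[m [lt_mn Snm eq_f]]].
  by have /negP[] := mex_notin A; apply/mem_A/f_onto.
by case: (f_neq _ _ lt_mn Snm).
Qed.

(** * Classes that are progressions of difference [a] *)

(** Write n = q k a + j a + t with j < k and t < a: [q] and [t] determine the class, [j] the place
    in it, and q a + t is the rank of the class. *)
Lemma nim_seq_multiples (X : {fset nat}) (a k : nat) :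
    0 < a -> 0 < k ->
    (forall x, x \in X -> a <= x) ->
    (forall j, 0 < j < k -> j * a \in X) ->
    (forall y, 0 < y -> exists2 j, j < k & y + j * a \notin X) ->
  forall n, nim_seq (all_but X) n = n %/ (k * a) * a + n %% a.
Proof.
move=> a_gt0 k_gt0 X_ge X_mul X_shift.
have ka_gt0 : 0 < k * a by rewrite muln_gt0 k_gt0.
have split3 n : exists q j t, [/\ j < k, t < a, n = q * (k * a) + j * a + t,
    n %/ (k * a) = q & n %% a = t].
  exists (n %/ (k * a)), (n %% (k * a) %/ a), (n %% a).
  rewrite ltn_divLR // !ltn_pmod //; split=> //.
  rewrite {1}(divn_eq n (k * a)) -addnA; congr (_ + _).
  by rewrite {1}(divn_eq (n %% (k * a)) a) modn_dvdm // dvdn_mull.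
have fE q j t : j < k -> t < a ->
    let n := q * (k * a) + j * a + t in n %/ (k * a) * a + n %% a = q * a + t.
  move=> ltjk ltta /=; congr (_ * _ + _).
    have lt_r : j * a + t < k * a.
      have : j.+1 * a <= k * a by rewrite leq_mul2r ltjk orbT.
      by rewrite mulSn; lia.
    by rewrite -addnA divnMDl // divn_small // addn0.
  by rewrite mulnA -mulnDl modnMDl modn_small.
apply: nim_seq_unique => [m n lt_mn /andP[_ /negP nX] eq_f | n v].
  have [q [j [t [ltjk ltta em _ _]]]] := split3 m.
  have [q' [j' [t' [ltjk' ltta' en _ _]]]] := split3 n.
  move: eq_f; rewrite em en !fE // => eq_f.
  have eq_t : t = t'.
    by have := congr1 (modn^~ a) eq_f; rewrite /= !modnMDl !modn_small.
  have eq_q : q = q'.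
    have := congr1 (divn^~ a) eq_f.
    by rewrite /= !divnMDl // !divn_small // !addn0.
  subst t' q'; apply: nX.
  have lt_j : j < j'.
    rewrite ltnNge; apply/negP=> le_j.
    have : j' * a <= j * a by rewrite leq_mul2r le_j orbT.
    by lia.
  have -> : n - m = (j' - j) * a by rewrite mulnBl; lia.
  by apply: X_mul; lia.
have [q [j [t [ltjk ltta -> _ _]]]] := split3 n.
rewrite fE // {n} => lt_v.
pose q0 := v %/ a; pose t0 := v %% a.
have ltt0 : t0 < a by rewrite ltn_pmod.
have ev : v = q0 * a + t0 by exact: divn_eq.
have le_q : q0 <= q.
  have : q0 < q.+1; last by [].
  by rewrite -(ltn_pmul2r a_gt0) mulSn; lia.
case: (ltngtP q0 q) le_q => // [lt_q _ | eq_q _].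
  have le_blk : q0 * (k * a) + k * a <= q * (k * a).
    by rewrite addnC -mulSn leq_mul2r lt_q orbT.
  (* [y] is the distance down to the last member of the earlier class; [X_shift] walks back along
     that class to a distance outside [X]. *)
  pose y := q * (k * a) + j * a + t - (q0 * (k * a) + k.-1 * a + t0).
  have ek : k * a = k.-1 * a + a by rewrite -{1}(prednK k_gt0) mulSn addnC.
  have [|i ltik nX] := X_shift y; first by rewrite /y; lia.
  exists (q0 * (k * a) + (k.-1 - i) * a + t0); rewrite fE //; last by lia.
  have le_i : i * a <= k.-1 * a by rewrite leq_mul2r; lia.
  have -> : (k.-1 - i) * a = k.-1 * a - i * a by rewrite mulnBl.
  split=> //; first by lia.
  set w := _ - _; have -> : w = y + i * a by rewrite /w /y; lia.
  by rewrite /all_but nX andbT /y; lia.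
(* Within one block, the member with the same [j] is less than [a] away, below all of [X]. *)
subst q; exists (q0 * (k * a) + j * a + t0); rewrite fE //.
split=> //; first by lia.
rewrite /all_but; apply/andP; split; first by lia.
by apply/negP=> /X_ge; lia.
Qed.

Lemma nim_seq_multiples_periodic (X : {fset nat}) (a k : nat) :
    0 < a -> 0 < k ->
    (forall x, x \in X -> a <= x) ->
    (forall j, 0 < j < k -> j * a \in X) ->
    (forall y, 0 < y -> exists2 j, j < k & y + j * a \notin X) ->
  forall n, nim_seq (all_but X) (n + k * a) = nim_seq (all_but X) n + a.
Proof.
move=> a_gt0 k_gt0 X_ge X_mul X_shift n.
rewrite !(nim_seq_multiples _ a k) //.
rewrite divnDr ?dvdnn // divnn muln_gt0 a_gt0 k_gt0 /= addn1 mulSn.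
by rewrite addnC [n + _]addnC modnMDl; lia.
Qed.

(** The count grows by at most one at a time. This supplies a root of each smaller rank. *)
Lemma count_iota_surj (P : pred nat) N v :
  v < count P (iota 0 N) -> exists r, [/\ r < N, P r & count P (iota 0 r) = v].
Proof.
elim: N => // N IHN; rewrite -[N.+1]addn1 iotaD count_cat /= addn0 => lt_v.
have [/IHN[r [ltr Pr er]] | le_v] := ltnP v (count P (iota 0 N)).
  by exists r; split=> //; lia.
by exists N; case: (P N) lt_v => /=; split=> //; lia.
Qed.

(** * Greedy classes when c = a + b *)

Section SumTriple.

Variables a b : nat.
Hypotheses (a_gt0 : 0 < a) (lt_ab : a < b).

Let c := a + b.

(* [used m i]: position [i] lies in the class of some root below [m]. *)
Fixpoint used (m i : nat) : bool :=
  if m is r.+1 then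
    used r i || ~~ used r r &&
      [|| i == r, i == r + (if used r (r + a) then b else a) | i == r + c]
  else false.

Definition root r := ~~ used r r.
(** Repeats the conditional inside [used], so that [usedS] holds by conversion. *)
Definition step r := if used r (r + a) then b else a.
Definition in_class r i := root r && [|| i == r, i == r + step r | i == r + c].

Lemma usedS m i : used m.+1 i = used m i || in_class m i.
Proof. by []. Qed.

Lemma step_ab r : step r = a \/ step r = b.
Proof. by rewrite /step; case: ifP; [right | left]. Qed.

Lemma usedP m i : reflect (exists2 r, r < m & in_class r i) (used m i).
Proof.
elim: m => [|m IHm]; first by apply: ReflectF; case.
rewrite usedS; apply: (iffP orP) => [[/IHm[r ltr cr] | cm] | [r]].
- by exists r => //; lia.
- by exists m.
rewrite ltnS leq_eqVlt => /predU1P[-> | ltr] cr; first by right.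
by left; apply/IHm; exists r.
Qed.

Lemma in_class_ge r i : in_class r i -> r <= i.
Proof. by case/andP=> _ /or3P[] /eqP->; rewrite ?leq_addr. Qed.

Lemma used_ge m i : m + c <= i -> used m i = false.
Proof.
move=> le_i; apply/negbTE/negP=> /usedP[r ltr /andP[_]].
by have [->|->] := step_ab r; rewrite /c in le_i *; lia.
Qed.

Lemma root_free_b r : root r -> used r (r + b) = false.
Proof.
move=> root_r; apply/negbTE/negP=> /usedP[r' ltr' /andP[root_r']].
(* Comparing offsets leaves only r + b = r' + c. *)
have [es|es] := step_ab r'; rewrite es /c => cl;
  have er : r = r' + a by lia.
all: case/negP: (root_r); apply/usedP.
  by exists r'; rewrite // /in_class root_r' er es eqxx !orbT.
(* Here [r'] stepped by [b] because r' + a, which is [r], was already taken. *)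
move: es; rewrite /step; case: ifP => [/usedP[q ltq cq] _ | _ ?]; last by lia.
by exists q; [lia | rewrite er].
Qed.

Lemma root_free r i : root r -> in_class r i -> used r i = false.
Proof.
move=> root_r /andP[_ /or3P[] /eqP->].
- exact: negbTE.
- by rewrite /step; case: ifP => // _; apply: root_free_b.
exact: used_ge.
Qed.

Lemma in_class_uniq r r' i : in_class r i -> in_class r' i -> r = r'.
Proof.
wlog lt_r : r r' / r < r' => [th cr cr' | cr cr'].
  by case: (ltngtP r r') => // lt_r; [exact: th | apply/esym/th].
have /andP[root_r' _] := cr'.
by have /negP[] := negbT (root_free _ _ root_r' cr'); apply/usedP; exists r.
Qed.

(** A root never exceeds its members, so a bounded search suffices; [root_ofP] rules out the default
    i + 1 of a failed [find]. *)
Definition root_of i := find (in_class^~ i) (iota 0 i.+1).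

Lemma root_ofP i : in_class (root_of i) i.
Proof.
have hasC : has (in_class^~ i) (iota 0 i.+1).
  have [root_i | ] := boolP (root i).
    apply/hasP; exists i; first by rewrite mem_iota; lia.
    by rewrite /in_class root_i eqxx.
  rewrite negbK => /usedP[r ltr cr].
  by apply/hasP; exists r; rewrite ?mem_iota //; lia.
have := nth_find 0 hasC; rewrite nth_iota //.
by rewrite has_find size_iota in hasC.
Qed.

Definition rank r := count root (iota 0 r).

Lemma rankS r : rank r.+1 = rank r + root r.
Proof. by rewrite /rank -addn1 iotaD count_cat /= addn0. Qed.

Lemma rank_mono r r' : r <= r' -> rank r <= rank r'.
Proof.
move/subnKC <-; elim: (r' - r) => [|d IHd]; first by rewrite addn0.
by rewrite addnS rankS (leq_trans IHd) ?leq_addr.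
Qed.

Lemma rank_lt r r' : root r -> r < r' -> rank r < rank r'.
Proof. by move=> root_r /rank_mono; rewrite rankS root_r addn1. Qed.

(** Offsets 0, a, c and 0, b, c both have differences a, b, c, so no move stays inside a class. *)
Lemma nim_seq_rank (X : {fset nat}) :
    b != 2 * a -> X =i [:: a; b; c] ->
  forall n, nim_seq (all_but X) n = rank (root_of n).
Proof.
move=> b_neq memX; apply: nim_seq_unique => [m n lt_mn | n v].
  rewrite /all_but memX !inE => /andP[_ nX] eq_rk.
  have cm := root_ofP m; have cn := root_ofP n.
  have eq_r : root_of m = root_of n.
    case: (ltngtP (root_of m) (root_of n)) => // /rank_lt lt_r.
      by have /andP[/lt_r] := cm; rewrite eq_rk ltnn.
    by have /andP[/lt_r] := cn; rewrite eq_rk ltnn.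
  rewrite -eq_r in cn; move: cm cn => /andP[_ cm] /andP[_ cn].
  by move: nX cm cn; rewrite /c; have [->|->] := step_ab (root_of m); lia.
case/count_iota_surj=> r [ltr root_r erk].
have cn := root_ofP n; have le_n := in_class_ge _ _ cn.
have class_rank i : in_class r i -> rank (root_of i) = v.
  by move=> ci; rewrite (in_class_uniq _ _ _ (root_ofP i) ci).
have nuse : used r n = false.
  apply/negbTE/negP=> /usedP[q ltq cq].
  by have := in_class_uniq _ _ _ cq cn; lia.
have ncl : ~~ in_class r n.
  by apply/negP=> cr; have := in_class_uniq _ _ _ cr cn; lia.
have [Xr | nXr] := boolP (n - r \in X); last first.
  exists r; split; first by lia.
    by rewrite /all_but nXr andbT; lia.
  by apply: class_rank; rewrite /in_class root_r eqxx.
move: Xr; rewrite memX !inE => /or3P[] /eqP e_nr.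
(* Since r + a is still free at [r], the class of [r] would have taken it. *)
- have en : n = r + a by lia.
  case/negP: ncl; rewrite /in_class root_r /step -en nuse en eqxx.
  by rewrite !orbT.
- have en : n = r + b by lia.
  have es : step r = a.
    have [//|es] := step_ab r.
    by case/negP: ncl; rewrite /in_class root_r es en eqxx !orbT.
  (* The move b - a is legal because b differs from 2 a. *)
  exists (r + a); split; first by lia.
    by rewrite /all_but memX !inE en /c; lia.
  by apply: class_rank; rewrite /in_class root_r es eqxx !orbT.
have en : n = r + c by rewrite /c in e_nr *; lia.
by case/negP: ncl; rewrite /in_class root_r en eqxx !orbT.
Qed.

(** * Reversible evolution of the window *)

(** By [used_ge] only the offsets below [c] carry information. *)
Definition same_window m n := forall i, used m (m + i) = used n (n + i).

Lemma same_window_root m n : same_window m n -> root m = root n.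
Proof. by move=> /(_ 0); rewrite !addn0 /root => ->. Qed.

Lemma in_class_offset m i :
  in_class m (m + i) = root m && [|| i == 0, i == step m | i == c].
Proof.
rewrite /in_class !eqn_add2l; congr (_ && (_ || _)).
by rewrite -[RHS](eqn_add2l m) addn0.
Qed.

Lemma same_window_class m n i :
  same_window m n -> in_class m (m + i) = in_class n (n + i).
Proof.
by move=> w; rewrite !in_class_offset (same_window_root _ _ w) /step w.
Qed.

Lemma same_windowS m n : same_window m n -> same_window m.+1 n.+1.
Proof.
by move=> w i; rewrite !addSnnS !usedS w (same_window_class _ _ _ w).
Qed.

(** Before [m] is processed, m + c is out of reach, so its later state reveals whether [m] was a
    root. *)
Lemma root_next m : root m = used m.+1 (m + c).
Proof.
by rewrite usedS used_ge // /in_class eqxx !orbT andbT.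
Qed.

(** By [root_free_b], m + b can only become used through a step [b] from [m]. *)
Lemma step_next m : root m -> step m = if used m.+1 (m + b) then b else a.
Proof.
move=> root_m; rewrite usedS root_free_b // in_class_offset root_m /= /c.
by have [->|->] := step_ab m; case: ifP; lia.
Qed.

Lemma same_window_pred m n : same_window m.+1 n.+1 -> same_window m n.
Proof.
move=> w; have wS i : 0 < i -> used m.+1 (m + i) = used n.+1 (n + i).
  by case: i => // i _; have := w i; rewrite !addSnnS.
have eq_root : root m = root n by rewrite !root_next wS // /c; lia.
have eq_cl i : in_class m (m + i) = in_class n (n + i).
  rewrite !in_class_offset eq_root; case root_n: (root n) => //=.
  by rewrite (step_next m) ?eq_root // (step_next n) // wS; lia.
(* Offset 0 has left the later window and is recovered from [root]; elsewhere the class of [m] is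
   erased, its members having been free. *)
case=> [|i]; first by rewrite !addn0; apply: negb_inj.
have := wS i.+1 isT; rewrite !usedS eq_cl.
case cl: (in_class n _); last by rewrite !orbF.
have cl' : in_class m (m + i.+1) by rewrite eq_cl.
by rewrite !root_free //; [case/andP: cl | case/andP: cl'].
Qed.

Lemma window_returns : exists2 p, 0 < p & same_window 0 p.
Proof.
pose win m : {ffun 'I_c -> bool} := [ffun i : 'I_c => used m (m + i)].
have win_same m n : win m = win n -> same_window m n.
  move=> /ffunP eq_w i; have [lt_i | le_i] := ltnP i c.
    by have := eq_w (Ordinal lt_i); rewrite !ffunE.
  by rewrite !used_ge // leq_add2l.
have [m [p [p_gt0 w]]] : exists m p, 0 < p /\ same_window m (m + p).
  pose N := #|{ffun 'I_c -> bool}|.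
  have /injectivePn[x [y neq_xy eq_w]] : ~~ injectiveb (fun i : 'I_N.+1 => win i).
    by apply/negP=> /injectiveP/leq_card; rewrite card_ord ltnn.
  have := win_same _ _ eq_w; have := win_same _ _ (esym eq_w).
  have : val x != val y by [].
  case: (ltngtP (val x) (val y)) => //= lt_xy _ w1 w2; have le_xy := ltnW lt_xy.
    by exists (val x), (val y - val x); rewrite subnKC // subn_gt0.
  by exists (val y), (val x - val y); rewrite subnKC // subn_gt0.
(* Reversibility pulls the repetition back to 0, leaving no preperiod. *)
exists p => //; elim: m w => [|m IHm] w; first by rewrite add0n in w.
by apply/IHm/same_window_pred.
Qed.

Lemma nim_seq_sum_triple_periodic (X : {fset nat}) :
    b != 2 * a -> X =i [:: a; b; c] ->
  exists p s, 1 <= p /\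
    forall n, nim_seq (all_but X) (n + p) = nim_seq (all_but X) n + s.
Proof.
move=> b_neq memX; have [p p_gt0 w0] := window_returns.
have w m : same_window m (m + p).
  by elim: m => [|m IHm]; [rewrite add0n | apply: same_windowS].
(* The increment is the number of roots in one period. *)
exists p, (rank p); split=> // n; rewrite !nim_seq_rank //.
have rank_shift r : rank (r + p) = rank r + rank p.
  elim: r => [|r IHr]; first by rewrite add0n.
  by rewrite addSn !rankS IHr (same_window_root _ _ (w r)) addnAC.
rewrite -rank_shift; congr rank.
apply: in_class_uniq (root_ofP _) _.
have cn := root_ofP n; have := in_class_ge _ _ cn; move: (root_of n) cn => r.
move=> cr /subnKC en; have := same_window_class _ _ (n - r) (w r).
by rewrite addnAC en cr => <-.
Qed.

End SumTriple.

Theorem mainTheorem1 (X : {fset nat})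
    (X_pos : forall x : nat, x \in X -> 0 < x)
    (X_card : #|` X|%fset = 3) :
  exists p s : nat, 1 <= p /\
    forall n : nat, nim_seq (all_but X) (n + p) = nim_seq (all_but X) n + s.
Proof.
have [a [b [c [lt_ab lt_bc memX]]]] :
    exists a b c, [/\ a < b, b < c & X =i [:: a; b; c]].
  have : sorted ltn (sort leq X).
    by rewrite ltn_sorted_uniq_leq sort_uniq fset_uniq sort_sorted //; exact: leq_total.
  have : size (sort leq X) = 3 by rewrite size_sort.
  have : X =i sort leq X by move=> x; rewrite mem_sort.
  case: (sort leq X) => [|a [|b [|c []]]] //= memX _ /and3P[lt_ab lt_bc _].
  by exists a, b, c.
have a_gt0 : 0 < a by apply: X_pos; rewrite memX inE eqxx.
have X_ge x : x \in X -> a <= x by rewrite memX !inE; lia.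
have multiples k : 0 < k -> (forall j, 0 < j < k -> j * a \in X) ->
    (forall y, 0 < y -> exists2 j, j < k & y + j * a \notin X) ->
    exists p s, 1 <= p /\
      forall n, nim_seq (all_but X) (n + p) = nim_seq (all_but X) n + s.
  move=> k_gt0 X_mul X_shift; exists (k * a), a.
  rewrite muln_gt0 k_gt0; split=> //.
  exact: nim_seq_multiples_periodic.
have memXP x : x \in X = [|| x == a, x == b | x == c] by rewrite memX !inE.
have [X2a | nX2a] := boolP (2 * a \in X).
  have [X3a | nX3a] := boolP (3 * a \in X).
    (* Here [X] consists of a, 2 a, 3 a, and y + 3 a exceeds them all. *)
    apply: (multiples 4) => // [[|[|[|[|j]]]] // _ | y y_gt0].
      by rewrite mul1n memXP eqxx.
    exists (if y \in X then 3 else 0); first by case: ifP.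
    by move: X2a X3a; case: ifP; rewrite !memXP; lia.
  apply: (multiples 3) => // [[|[|[|j]]] // _ | y y_gt0].
    by rewrite mul1n memXP eqxx.
  (* If y, y + a and y + 2 a all lay in [X], they would exhaust it, forcing y = a and 3 a in [X]. *)
  exists (if y \notin X then 0 else if y + a \notin X then 1 else 2).
    by case: ifP => // _; case: ifP.
  by move: X2a nX3a; case: ifP; [|case: ifP]; rewrite !memXP; lia.
have [ec | nec] := eqVneq c (a + b).
  apply: (nim_seq_sum_triple_periodic a b a_gt0 lt_ab); last by rewrite -ec.
  by move: nX2a; rewrite memXP; lia.
apply: (multiples 2) => // [[|[|j]] // _ | y y_gt0].
  by rewrite mul1n memXP eqxx.
(* Two elements of [X] differing by [a] would give 2 a in [X] or c = a + b. *)
exists (if y \in X then 1 else 0); first by case: ifP.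
by move: nX2a; case: ifP; rewrite !memXP; lia.
Qed.
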